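(* Consider the linear time-periodic problem $\mathbf u'(t)=A(t)\mathbf u(t)+\mathbf g(t)$, $t\in[0,T]$, $\mathbf u(0)=\mathbf u(T)$, where $A(t)\in\mathbb R^{d\times d}$ and $\mathbf g(t)\in\mathbb R^d$ are $T$-periodic. Assume that the fine and coarse propagators $\mathcal F_n,\mathcal G_n:\mathbb R^d\to\mathbb R^d$ ($0\le n<N$) are affine, with linear parts $F_n$ and $G_n$, and that the fine--coarse discrepancy $\mathcal D_n=\mathcal F_n-\mathcal G_n$ satisfies, for a constant $C_D>0$ independent of $n$ and $\Delta T$, $$\|\mathcal D_n(\mathbf x)-\mathcal D_n(\mathbf y)\|_2\le C_D(\Delta T)^{p+1}\|\mathbf x-\mathbf y\|_2,\qquad \mathbf x,\mathbf y\in\mathbb R^d,\ n=0,\ldots,N-1,$$ where $\Delta T$ is the coarse time interval length and $p$ is the order of the coarse propagator. Let $P$ be an arbitrary orthogonal projection on $\mathbb R^d$, set $Q:=I-P$, and let $\widehat{\mathcal C}_P$ be the block-cyclic matrix with diagonal blocks $I$ and cyclic subdiagonal blocks $-(F_nP+G_nQ)$. Suppose $\widehat{\mathcal C}_P$ is invertible and let $\Gamma:=\|\widehat{\mathcal C}_P^{-1}\|_{\infty\to\infty}$. Let $\mathbf U^k\in(\mathbb R^d)^N$ and let $\mathbf U^{k+1}\in(\mathbb R^d)^N$ be given by the projection-based PP-PC update using the discrepancy-form propagator with $P^k=P$, that is, $$\mathbf U_{n+1}^{k+1}=\mathcal F_n(\mathbf U_n^k)+\mathcal H_{P,n}(\mathbf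 U_n^{k+1})-\mathcal H_{P,n}(\mathbf U_n^k),\qquad n=0,\ldots,N-1,\qquad \mathbf U_N^{k+1}=\mathbf U_0^{k+1}.$$ Then its error satisfies $$E_\infty^{k+1}\le\Gamma\,C_D(\Delta T)^{p+1}\max_{0\le n<N}\|Q\mathbf e_n^k\|_2 .$$
   Context: Setting. $T>0$, $N$ is a positive integer, $\Delta T=T/N$, $T_n=n\Delta T$; $A$ and $\mathbf g$ are continuous. For $0\le n<N$, $\mathcal F_n(\mathbf x)$ (resp. $\mathcal G_n(\mathbf x)$) is an accurate (resp. less accurate but cheaper) approximation at time $T_{n+1}$ of the solution of the evolution problem starting from $\mathbf x$ at time $T_n$. $I$ is the identity on $\mathbb R^d$. Histories are elements $\mathbf w=(\mathbf w_0,\ldots,\mathbf w_{N-1})\in(\mathbb R^d)^N$; history indices are taken modulo $N$ (so $\mathbf w_N=\mathbf w_0$). Norms: $\|\mathbf w\|_\infty:=\max_{0\le n<N}\|\mathbf w_n\|_2$, and $\|S\|_{\infty\to\infty}:=\sup_{\mathbf w\ne 0}\|S\mathbf w\|_\infty/\|\mathbf w\|_\infty$. Discrepancy-form propagator: $\mathcal H_{P,n}(\mathbf x):=\mathcal G_n(\mathbf x)+\mathcal D_n(P\mathbf x)$. Rowwise, $(\widehat{\mathcal C}_P\mathbf w)_{n+1}=\mathbf w_{n+1}-(F_nP+G_nQ)\mathbf w_n$, $n=0,\ldots,N-1$, indices modulo $N$. Fine periodic reference: $\mathbf u^\star=(\mathbf u_0^\star,\ldots,\mathbf u_{N-1}^\star)\in(\mathbb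 R^d)^N$ satisfying $\mathbf u_{n+1}^\star=\mathcal F_n(\mathbf u_n^\star)$ for $n=0,\ldots,N-1$, with $\mathbf u_N^\star=\mathbf u_0^\star$; its existence is assumed. Errors: $\mathbf e_n^j:=\mathbf u_n^\star-\mathbf U_n^j$ and $E_\infty^j:=\max_{0\le n<N}\|\mathbf e_n^j\|_2$ for $j\in\{k,k+1\}$. *)

(* Defs.v *)
From HB Require Import structures.
From mathcomp Require Import all_boot all_order all_algebra.
From mathcomp Require Import all_classical all_reals all_analysis.

Set Implicit Arguments.
Unset Strict Implicit.
Unset Printing Implicit Defensive.

Import Order.TTheory GRing.Theory Num.Theory.
Import numFieldNormedType.Exports.

Local Open Scope classical_set_scope.
Local Open Scope ring_scope.

(* The canonical norm on matrices in the library is the max norm, hence this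
   separate Euclidean norm. *)
Definition norm2 (R : realType) (d : nat) (x : 'cV[R]_d) : R :=
  Num.sqrt (\sum_(i < d) x i 0 ^+ 2).

(* Periodic histories are functions on 'I_N; the index n + 1 modulo N is
   [ordS n]. *)
Definition history (R : realType) (d N : nat) := 'I_N -> 'cV[R]_d.

(* All the terms are nonnegative, so the base value 0 is harmless. *)
Definition maxnorm2 (R : realType) (d N : nat) (w : history R d N) : R :=
  \big[Num.max/0]_(n < N) norm2 (w n).

(* Block vectors in (R^d)^N are columns of size \sum_(n < N) d, split into
   blocks by [submxcol]. *)
Definition blocks (R : realType) (d N : nat)
    (w : 'cV[R]_(\sum_(n < N) d)) : history R d N :=
  @submxcol R N (fun _ => d) 1 w.

Definition opnorm_inf (R : realType) (d N : nat)
    (S : 'M[R]_(\sum_(n < N) d)) : R :=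
  sup [set maxnorm2 (blocks (S *m w)) / maxnorm2 (blocks w)
      | w in [set w : 'cV[R]_(\sum_(n < N) d) | w != 0]].

Definition affine_with_linear_part (R : realType) (d : nat)
    (f : 'cV[R]_d -> 'cV[R]_d) (M : 'M[R]_d) : Prop :=
  exists b : 'cV[R]_d, forall x, f x = M *m x + b.

Definition orthogonal_projection (R : realType) (d : nat) (P : 'M[R]_d) : Prop :=
  P *m P = P /\ P^T = P.

Definition discrepancy (R : realType) (d N : nat)
    (cF cG : 'I_N -> 'cV[R]_d -> 'cV[R]_d) (n : 'I_N) (x : 'cV[R]_d) : 'cV[R]_d :=
  cF n x - cG n x.

Definition discrepancy_propagator (R : realType) (d N : nat)
    (cF cG : 'I_N -> 'cV[R]_d -> 'cV[R]_d) (P : 'M[R]_d)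
    (n : 'I_N) (x : 'cV[R]_d) : 'cV[R]_d :=
  cG n x + discrepancy cF cG n (P *m x).

(* The two contributions are added so that for N = 1, where the diagonal and
   the cyclic subdiagonal coincide, the single block is I - (F P + G Q). *)
Definition cyclic_matrix (R : realType) (d N : nat)
    (F G : 'I_N -> 'M[R]_d) (P : 'M[R]_d) : 'M[R]_(\sum_(n < N) d) :=
  \mxblock_(i < N, j < N)
    ((if i == j then 1%:M else 0)
     - (if i == ordS j then F j *m P + G j *m (1%:M - P) else 0)).

Lemma cyclic_matrix_row (R : realType) (d N : nat)
    (F G : 'I_N -> 'M[R]_d) (P : 'M[R]_d) (w : history R d N) (n : 'I_N) :
  blocks (cyclic_matrix F G P *m \mxcol_(i < N) w i) (ordS n) =
  w (ordS n) - (F n *m P + G n *m (1%:M - P)) *m w n.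
Proof.
rewrite /blocks /cyclic_matrix mxblockEv mxcol_mul mxcolK mul_mxrow_mxcol.
under eq_bigr do rewrite mulmxBl.
rewrite sumrB (bigD1 (ordS n)) //= eqxx mul1mx big1 ?addr0; last first.
  by move=> i; rewrite eq_sym => /negbTE ->; rewrite mul0mx.
rewrite [X in _ - X](bigD1 n) //= eqxx big1 ?addr0 // => i ni.
by rewrite (inj_eq (@ordS_inj N)) eq_sym (negbTE ni) mul0mx.
Qed.

Definition periodic_trajectory (R : realType) (d N : nat)
    (cF : 'I_N -> 'cV[R]_d -> 'cV[R]_d) (u : history R d N) : Prop :=
  forall n : 'I_N, u (ordS n) = cF n (u n).

Definition PPPC_update (R : realType) (d N : nat)
    (cF cG : 'I_N -> 'cV[R]_d -> 'cV[R]_d) (P : 'M[R]_d)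
    (Uk Uk1 : history R d N) : Prop :=
  forall n : 'I_N,
    Uk1 (ordS n) = cF n (Uk n)
      + discrepancy_propagator cF cG P n (Uk1 n)
      - discrepancy_propagator cF cG P n (Uk n).

(* Main.v *)
Require Import Defs.
From HB Require Import structures.
From mathcomp Require Import all_boot all_order all_algebra.
From mathcomp Require Import all_classical all_reals all_analysis.
From mathcomp Require Import ring.

(** The update is linear in the errors once the reference is subtracted.  The
linear part of [discrepancy_propagator] is [F n *m P + G n *m Q], with
[Q = 1 - P], which is the block that appears in [cyclic_matrix].  Moving the
new error to one side gives the block-cyclic system whose right-hand side is
[F n e - (F n P + G n Q) e = (F n - G n) Q e], where [e] is the old error: the
projection removes the part of the old error that lies in the range of [P].
This right-hand side is an increment of the affine discrepancy, between [Q e]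
and 0, so that the Lipschitz bound applies to it ([PPPC_error_recurrence]).
Inverting the system costs the factor [opnorm_inf].

The operator norm is a supremum of real numbers, and a supremum of an
unbounded set carries no information; the factor is therefore a bound only
because the quotients that define it are bounded.  This is the
finite-dimensional fact [mulmx_maxnorm2_bounded], which yields the defining
inequality of an operator norm, [maxnorm2_mulmx_le]. *)

Set Implicit Arguments.
Unset Strict Implicit.
Unset Printing Implicit Defensive.

Import Order.TTheory GRing.Theory Num.Theory.
Import numFieldNormedType.Exports.

Local Open Scope classical_set_scope.
Local Open Scope ring_scope.

(** * Euclidean norm and maximum norm *)

Lemma norm2_0 (R : realType) (d : nat) : norm2 (0 : 'cV[R]_d) = 0.
Proof. by rewrite /norm2 big1 ?sqrtr0 // => i _; rewrite mxE expr0n. Qed.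

Lemma entry_le_norm2 (R : realType) (d : nat) (x : 'cV[R]_d) (i : 'I_d) :
  `|x i 0| <= norm2 x.
Proof.
rewrite -sqrtr_sqr; apply: ler_wsqrtr.
by rewrite (bigD1 i) //= lerDl sumr_ge0 // => j _; apply: sqr_ge0.
Qed.

(** The factor [d] instead of its square root is crude, but only a finite
constant is ever required of this estimate. *)
Lemma norm2_le_entries (R : realType) (d : nat) (x : 'cV[R]_d) (c : R) :
  0 <= c -> (forall i, `|x i 0| <= c) -> norm2 x <= d%:R * c.
Proof.
move=> c0 xc; have dc0 : 0 <= d%:R * c by rewrite mulr_ge0.
rewrite -[leRHS](ger0_norm dc0) -sqrtr_sqr; apply: ler_wsqrtr.
apply: (@le_trans _ _ (\sum_(i < d) c ^+ 2)).
  by apply: ler_sum => i _; rewrite -real_normK ?num_real // lerXn2r ?nnegrE.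
rewrite sumr_const card_ord exprMn -[leLHS]mulr_natl ler_wpM2r ?sqr_ge0 //.
by rewrite -natrX ler_nat; case: (d) => // k; rewrite expnS leq_pmulr ?expn_gt0.
Qed.

Lemma maxnorm2_ge0 (R : realType) (d N : nat) (w : history R d N) :
  0 <= maxnorm2 w.
Proof. exact: bigmax_ge_id. Qed.

Lemma norm2_le_maxnorm2 (R : realType) (d N : nat) (w : history R d N) n :
  norm2 (w n) <= maxnorm2 w.
Proof. exact: (le_bigmax _ (fun n => norm2 (w n))). Qed.

Lemma maxnorm2_le (R : realType) (d N : nat) (w : history R d N) (c : R) :
  0 <= c -> (forall n, norm2 (w n) <= c) -> maxnorm2 w <= c.
Proof. by move=> c0 wc; apply: bigmax_le. Qed.

Lemma entry_le_maxnorm2 (R : realType) (d N : nat)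
    (w : 'cV[R]_(\sum_(n < N) d)) s :
  `|w s 0| <= maxnorm2 (blocks w).
Proof.
apply: le_trans (norm2_le_maxnorm2 _ (tagnat.sig1 s)).
apply: le_trans (entry_le_norm2 _ (tagnat.sig2 s)).
by rewrite mxE tagnat.sig2K.
Qed.

Lemma maxnorm2_blocks_gt0 (R : realType) (d N : nat)
    (w : 'cV[R]_(\sum_(n < N) d)) :
  w != 0 -> 0 < maxnorm2 (blocks w).
Proof.
move=> w0; rewrite lt_neqAle maxnorm2_ge0 andbT eq_sym.
apply: contra w0 => /eqP w0; apply/eqP/colP => s.
by apply/eqP; rewrite mxE -normr_le0 -w0 entry_le_maxnorm2.
Qed.

(** * The operator norm *)

(** The constant comes from bounding each entry of [S *m w] by the largest
entry of [w] times the sum of all [`|S s t|]. *)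
Lemma mulmx_maxnorm2_bounded (R : realType) (d N : nat)
    (S : 'M[R]_(\sum_(n < N) d)) :
  exists K : R, forall w,
    maxnorm2 (blocks (S *m w)) <= K * maxnorm2 (blocks w).
Proof.
set K := \sum_s \sum_t `|S s t|.
have K0 : 0 <= K by apply: sumr_ge0 => s _; apply: sumr_ge0.
exists (d%:R * K) => w.
have w0 := maxnorm2_ge0 (blocks w).
apply: maxnorm2_le => [|n]; first by rewrite !mulr_ge0.
rewrite -mulrA; apply: norm2_le_entries => [|i]; first by rewrite mulr_ge0.
rewrite !mxE; set s := tagnat.Rank n i.
apply: le_trans (ler_norm_sum _ _ _) _.
apply: (@le_trans _ _ (\sum_t `|S s t| * maxnorm2 (blocks w))).
  by apply: ler_sum => t _; rewrite normrM ler_wpM2l // entry_le_maxnorm2.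
rewrite -mulr_suml ler_wpM2r // /K [leRHS](bigD1 s) //= lerDl.
by apply: sumr_ge0 => s' _; apply: sumr_ge0.
Qed.

Lemma opnorm_inf_ratio_le (R : realType) (d N : nat)
    (S : 'M[R]_(\sum_(n < N) d)) w :
  w != 0 -> maxnorm2 (blocks (S *m w)) / maxnorm2 (blocks w) <= opnorm_inf S.
Proof.
move=> w0; apply: ub_le_sup; last by exists w.
have [K SK] := mulmx_maxnorm2_bounded S.
exists K => _ [v /= v0 <-].
by rewrite ler_pdivrMr ?SK // maxnorm2_blocks_gt0.
Qed.

(** In dimension 0 there is no nonzero vector, and the supremum of the empty set
is 0 by convention. *)
Lemma opnorm_inf_ge0 (R : realType) (d N : nat)
    (S : 'M[R]_(\sum_(n < N) d)) : 0 <= opnorm_inf S.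
Proof.
have [[w w0]|nw] := pselect (exists w : 'cV[R]_(\sum_(n < N) d), w != 0).
  apply: le_trans (opnorm_inf_ratio_le S w0).
  by rewrite divr_ge0 ?maxnorm2_ge0.
rewrite /opnorm_inf [X in sup X](_ : _ = set0) ?sup0 //.
by rewrite -subset0 => _ [w /= w0 _]; apply: nw; exists w.
Qed.

Lemma maxnorm2_mulmx_le (R : realType) (d N : nat)
    (S : 'M[R]_(\sum_(n < N) d)) w :
  maxnorm2 (blocks (S *m w)) <= opnorm_inf S * maxnorm2 (blocks w).
Proof.
have [->|w0] := eqVneq w 0; last first.
  by rewrite -ler_pdivrMr ?opnorm_inf_ratio_le // maxnorm2_blocks_gt0.
rewrite mulmx0; apply: maxnorm2_le => [|n].
  by rewrite mulr_ge0 ?opnorm_inf_ge0 ?maxnorm2_ge0.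
by rewrite /blocks submxcol0 norm2_0 mulr_ge0 ?opnorm_inf_ge0 ?maxnorm2_ge0.
Qed.

(** * The error equation *)

(** The affine offsets and the terms in the reference cancel; what remains of
the old error [ustar n - Uk n] is [(F n - G n) *m (1 - P)] applied to it.  It is
written as a difference of discrepancies, the form in which a Lipschitz bound
can be used. *)
Lemma PPPC_error_recurrence (R : realType) (d N : nat)
    (cF cG : 'I_N -> 'cV[R]_d -> 'cV[R]_d) (F G : 'I_N -> 'M[R]_d)
    (P : 'M[R]_d) (ustar Uk Uk1 : history R d N) (n : 'I_N) :
  affine_with_linear_part (cF n) (F n) ->
  affine_with_linear_part (cG n) (G n) ->
  periodic_trajectory cF ustar -> PPPC_update cF cG P Uk Uk1 ->
  (ustar (ordS n) - Uk1 (ordS n))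
    - (F n *m P + G n *m (1%:M - P)) *m (ustar n - Uk1 n)
  = discrepancy cF cG n ((1%:M - P) *m (ustar n - Uk n))
    - discrepancy cF cG n 0.
Proof.
move=> [a Fa] [b Gb] -> ->.
rewrite /discrepancy_propagator /discrepancy !Fa !Gb.
rewrite !(mulmxBr, mulmxBl, mulmxDl, mul1mx, mulmx1, mulmx0, mulmxN, mulNmx,
  mulmxA).
(* The products are opaque from here on, so that the goal is an identity in
   an abelian group, which holds entrywise. *)
move: (F n *m ustar n) (F n *m Uk n) (G n *m ustar n) (G n *m Uk n)
  (G n *m Uk1 n) (F n *m P *m ustar n) (F n *m P *m Uk n)
  (F n *m P *m Uk1 n) (G n *m P *m ustar n) (G n *m P *m Uk n)
  (G n *m P *m Uk1 n) => *.
by apply/matrixP => i j; rewrite !mxE; ring.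
Qed.

Theorem corollary4p2 (R : realType) (d : nat) (T : R) (hT : 0 < T)
    (A : R -> 'M[R]_d) (g : R -> 'cV[R]_d)
    (hA : continuous A) (hg : continuous g)
    (hAper : periodic A T) (hgper : periodic g T)
    (p : nat) (CD : R) (hCD : 0 < CD)
    (N : nat) (hN : (0 < N)%N)
    (cF cG : 'I_N -> 'cV[R]_d -> 'cV[R]_d) (F G : 'I_N -> 'M[R]_d)
    (hF : forall n, affine_with_linear_part (cF n) (F n))
    (hG : forall n, affine_with_linear_part (cG n) (G n))
    (hD : forall (x y : 'cV[R]_d) (n : 'I_N),
        norm2 (discrepancy cF cG n x - discrepancy cF cG n y)
        <= CD * (T / N%:R) ^+ p.+1 * norm2 (x - y))
    (P : 'M[R]_d) (hP : orthogonal_projection P)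
    (hC : cyclic_matrix F G P \in unitmx)
    (ustar : history R d N) (hustar : periodic_trajectory cF ustar)
    (Uk Uk1 : history R d N) (hU : PPPC_update cF cG P Uk Uk1) :
  maxnorm2 (fun n => ustar n - Uk1 n)
  <= opnorm_inf (invmx (cyclic_matrix F G P)) * CD * (T / N%:R) ^+ p.+1
     * maxnorm2 (fun n => (1%:M - P) *m (ustar n - Uk n)).
Proof.
set C := cyclic_matrix F G P; set q := maxnorm2 (fun n => _ *m _).
pose e1 : history R d N := fun n => ustar n - Uk1 n.
pose r := C *m \mxcol_(i < N) e1 i.
have dT0 : 0 <= CD * (T / N%:R) ^+ p.+1.
  by rewrite mulr_ge0 ?exprn_ge0 ?divr_ge0 // ltW.
have -> : maxnorm2 (fun n => ustar n - Uk1 n)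
    = maxnorm2 (blocks (invmx C *m r)).
  by apply: eq_bigr => n _; rewrite mulKmx // /blocks mxcolK.
apply: le_trans (maxnorm2_mulmx_le _ _) _.
rewrite -!mulrA ler_wpM2l ?opnorm_inf_ge0 // mulrA.
apply: maxnorm2_le => [|m]; first by rewrite mulr_ge0 ?maxnorm2_ge0.
(* The row of the system with index n + 1 modulo N is governed by step n. *)
rewrite -(ord_predK m); set n := ord_pred m.
rewrite /r cyclic_matrix_row (PPPC_error_recurrence (hF n) (hG n) hustar hU).
apply: le_trans (hD _ _ n) _; rewrite subr0 ler_wpM2l //.
exact: (norm2_le_maxnorm2 (fun n => _ *m (ustar n - Uk n))).
Qed.
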